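(* Let $S$ be a complete (commutative) semigroup. If $S$ is f-noetherian, then $S$ is finitely generated (as a semigroup).
   Context: A right congruence on a semigroup $S$ is an equivalence relation $\rho$ on $S$ such that $(a,b)\in\rho$ implies $(as,bs)\in\rho$ for all $s\in S$. The right congruence generated by a set $X\subseteq S\times S$ is the smallest right congruence on $S$ containing $X$; a right congruence is finitely generated if it is generated by some finite set $X$. The index of an equivalence relation is the cardinality of its set of equivalence classes. A semigroup $S$ is f-noetherian if every right congruence of finite index on $S$ is finitely generated. For a commutative semigroup $S$, write $x\leq y$ if $x\in yS^1$, where $S^1$ is $S$ with an identity adjoined if necessary. An archimedean semigroup is a commutative semigroup in which for all $a,b$ there exists $n>0$ with $a^n\leq b$. Every commutative semigroup $S$ is a semilattice of archimedean semigroups: the relation $a\sim b$ iff $a^n\leq b$ and $b^m\leq a$ for some $m,n>0$ is a congruence on $S$, $S/{\sim}$ is a semilattice, and the $\sim$-classes are archimedean subsemigroups, called the archimedean components of $S$. A commutative semigroup $S$ is complete if every archimedean component of $S$ contains an idempotent. *)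

(* Defs.v *)
From mathcomp Require Import all_boot.
From mathcomp Require Import mathcomp_extra boolp classical_sets functions cardinality.

Set Implicit Arguments.
Unset Strict Implicit.
Unset Printing Implicit Defensive.

Local Open Scope classical_set_scope.
Local Open Scope group_scope.

Section RightCongruences.
Variable S : semigroupType.

Definition equivalence (rho : set (S * S)) : Prop :=
  [/\ forall a, rho (a, a),
      forall a b, rho (a, b) -> rho (b, a)
    & forall a b c, rho (a, b) -> rho (b, c) -> rho (a, c)].

Definition right_congruence (rho : set (S * S)) : Prop :=
  equivalence rho /\ forall a b s, rho (a, b) -> rho (a * s, b * s).

Definition right_congruence_gen_by (X : set (S * S)) : set (S * S) :=
  smallest right_congruence X.

Definition fg_right_congruence (rho : set (S * S)) : Prop :=
  exists2 X : set (S * S), finite_set X & rho = right_congruence_gen_by X.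

Definition eq_classes (rho : set (S * S)) : set (set S) :=
  [set [set b | rho (a, b)] | a in [set: S]].

Definition finite_index (rho : set (S * S)) : Prop :=
  finite_set (eq_classes rho).

Definition f_noetherian : Prop :=
  forall rho : set (S * S),
    right_congruence rho -> finite_index rho -> fg_right_congruence rho.

Lemma right_congruence_gen_byP (X : set (S * S)) :
  right_congruence (right_congruence_gen_by X).
Proof.
split; first split.
- by move=> a rho [[[rhoR _ _] _] _]; apply: rhoR.
- by move=> a b ab rho rhoP; have [[[_ rhoS _] _] _] := rhoP; exact: rhoS (ab _ rhoP).
- move=> a b c ab bc rho rhoP; have [[[_ _ rhoT] _] _] := rhoP.
  exact: rhoT (ab _ rhoP) (bc _ rhoP).
- by move=> a b s ab rho rhoP; have [[_ rhoM] _] := rhoP; exact: rhoM (ab _ rhoP).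
Qed.

End RightCongruences.

Section Generation.
Variable S : semigroupType.

Definition subsemigroup (A : set S) : Prop :=
  forall a b, A a -> A b -> A (a * b).

Definition finitely_generated : Prop :=
  exists2 X : set S, finite_set X & smallest subsemigroup X = [set: S].

End Generation.

Section Archimedean.
Variable S : semigroupType.

(* A semigroup has no unit, so only the powers with 0 < n are meaningful
   ([spow x 1] is [x], [spow x 2] is [x * x]; [spow x 0] is a junk value). *)
Definition spow (x : S) (n : nat) : S := iterop n mul x x.

(* The set y S^1, which is {y} together with yS whether or not S already has an
   identity. *)
Definition mulS1 (y : S) : set S := [set y] `|` [set y * s | s in [set: S]].

Definition sle (x y : S) : Prop := mulS1 y x.

Definition arch_equiv (a b : S) : Prop :=
  (exists2 n, (0 < n)%N & sle (spow a n) b) /\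
  (exists2 m, (0 < m)%N & sle (spow b m) a).

Definition arch_components : set (set S) :=
  [set [set b | arch_equiv a b] | a in [set: S]].

Definition complete_semigroup : Prop :=
  forall A : set S, arch_components A -> exists2 e, A e & e * e = e.

End Archimedean.

Arguments f_noetherian : clear implicits.
Arguments finitely_generated : clear implicits.
Arguments complete_semigroup : clear implicits.

(* Main.v *)
Require Import Defs.
From mathcomp Require Import all_boot.
From mathcomp Require Import boolp classical_sets cardinality.

(** Write x <= y for the divisibility preorder [sle x y] and E for the set of
    idempotents. For e in E the set [up e] of elements above e is a prime
    filter: a product lies in it iff both factors do. Hence, for every finite
    list of prime filters, membership in its members is a right congruence
    with finitely many classes ([same_side]), so it is finitely generated.
    All uses of the noetherian hypothesis are of this kind.

    The basic tool is [fg_right_congruence_divisor]. If a right congruence rho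
    is generated by pairs with entries in a finite set F, then two rho-related
    elements a and b, compared through a translation p (the identity, or
    multiplication by an idempotent), satisfy p a <= p b unless p a <= p x for
    some x in F that p separates, up to mutual divisibility, from an element
    rho-related to x.

    E is finite. The filter generated by a multiplicatively closed set B of
    idempotents gives a finitely generated congruence, which forces B to have
    a least element ([least_idem]); so E satisfies the descending chain
    condition, and idempotents can be reasoned on by induction ([idem_ind]).
    The tool, applied to [up e] and multiplication by e, shows that the
    idempotents strictly below e lie below finitely many of them, so each
    down-set of E is finite by induction; the universal congruence shows that
    E is covered by finitely many down-sets.

    Each maximal subgroup G_e (the group of units of eS, [unit_group e]) is a
    homomorphic image of [up e], and it is finitely generated because the
    congruence that separates [up e] from its complement is
    ([fg_unit_group]).

    Since E is finite, the congruence whose classes are the archimedean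
    components is finitely generated too; let F carry its generators. If a
    lies outside its maximal subgroup, that is, if the idempotent of its
    component does not fix a, then a = x or a = x s with x in F, and x can be
    chosen such that the idempotent of its component does not fix a
    ([divide_step]). Only boundedly many powers of such an x divide a, so
    passing from a to s strictly lowers the number of divisors of a among
    suitably bounded powers of elements of F ([power_divisors_lt]). The descent
    stops in F or in some G_e, so S is generated by F together with finite
    generating sets of the groups G_e. *)

Set Implicit Arguments.
Unset Strict Implicit.
Unset Printing Implicit Defensive.

Local Open Scope classical_set_scope.
Local Open Scope group_scope.

(** * Generating sets of right congruences *)

Section FinitelyGenerated.
Variable S : semigroupType.

Lemma subsemigroup_smallest (Z : set S) :
  subsemigroup (smallest (@subsemigroup S) Z).
Proof. by move=> a b Za Zb A AP; exact: AP.1 (Za _ AP) (Zb _ AP). Qed.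

(** All that will be used of a generating set: any right congruence theta that
    contains the part of rho lying over some finite set F contains rho. Stating
    it with F instead of the pairs makes it symmetric in x and y. *)
Lemma fg_right_congruence_support (rho : set (S * S)) :
  fg_right_congruence rho ->
  exists2 F : set S, finite_set F &
    forall theta : set (S * S), right_congruence theta ->
      (forall x y, F x -> F y -> rho (x, y) -> theta (x, y)) ->
    rho `<=` theta.
Proof.
case=> X finX ->; exists (fst @` X `|` snd @` X).
  by rewrite finite_setU; split; apply: finite_image.
move=> theta thetaP XF; apply: smallest_sub => // -[x y] Xxy.
apply: XF; [by left; exists (x, y)|by right; exists (x, y)|].
exact: sub_gen_smallest.
Qed.

Lemma finite_index_fibers (T : finType) (c : S -> T) :
  finite_index [set xy | c xy.1 = c xy.2].
Proof.
apply: (@sub_finite_set _ _ ((fun t => [set b | t = c b]) @` [set: T])).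
  by move=> _ [a _ <-]; exists (c a).
exact/finite_image/finite_finset.
Qed.

(** The complement of such a set is a prime ideal (both are allowed to be
    empty). *)
Definition prime_filter (P : set S) := forall x y, P (x * y) <-> P x /\ P y.

Definition same_side (Ps : seq (set S)) : set (S * S) :=
  [set xy | forall P, P \in Ps -> (P xy.1 <-> P xy.2)].

Lemma right_congruence_same_side (Ps : seq (set S)) :
  (forall P, P \in Ps -> prime_filter P) -> right_congruence (same_side Ps).
Proof.
move=> PsP; split; first split.
- by move=> a P.
- by move=> a b ab P PPs; apply: iff_sym; apply: ab.
- by move=> a b c ab bc P PPs; apply: iff_trans (ab P PPs) (bc P PPs).
- move=> a b s ab P PPs; have /= abP := ab P PPs.
  by split=> /(PsP _ PPs)[? ?]; apply/(PsP _ PPs); split=> //; apply/abP.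
Qed.

Lemma fg_same_side (Ps : seq (set S)) :
  f_noetherian S -> (forall P, P \in Ps -> prime_filter P) ->
  fg_right_congruence (same_side Ps).
Proof.
move=> fnoethS PsP; apply: fnoethS; first exact: right_congruence_same_side.
pose c x := map_tuple (fun P : set S => `[< P x >]) (in_tuple Ps).
rewrite (_ : same_side Ps = [set xy | c xy.1 = c xy.2]).
  exact: finite_index_fibers.
apply/seteqP; split=> -[x y] /=.
  move=> xy; apply/val_inj/eq_in_map => P PP /=.
  exact/asbool_equiv_eq/xy.
move=> /(congr1 val)/eq_in_map xy P /xy exy.
by split=> /asboolP; [rewrite exy|rewrite -exy] => /asboolP.
Qed.

End FinitelyGenerated.

(** * Divisibility in commutative semigroups *)

Section Commutative.
Variable S : semigroupType.
Hypothesis commS : forall x y : S, commute x y.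

Implicit Types (a b e f g s u v x y z : S) (n : nat).

Definition idem e := e * e = e.

Let mulC x y : x * y = y * x. Proof. exact: commS. Qed.

Let mulAC x y z : x * y * z = x * z * y.
Proof. by rewrite -!mulgA (mulC y). Qed.

Let mulACA x y z u : (x * y) * (z * u) = (x * z) * (y * u).
Proof. by rewrite !mulgA (mulAC x y). Qed.

Lemma sleP x y : sle x y <-> x = y \/ exists s, x = y * s.
Proof.
split=> [[|[s _ <-]]|[|[s ->]]].
- by left.
- by right; exists s.
- by left.
- by right; exists s.
Qed.

Lemma sle_refl x : sle x x. Proof. by left. Qed.

Lemma sle_mulr x s : sle (x * s) x. Proof. by right; exists s. Qed.

Lemma sle_mull s x : sle (s * x) x. Proof. by rewrite mulC; apply: sle_mulr. Qed.

Lemma sle_trans y x z : sle x y -> sle y z -> sle x z.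
Proof.
move=> /sleP[->//|[s ->]] /sleP[->|[t ->]]; first exact: sle_mulr.
by rewrite -mulgA; apply: sle_mulr.
Qed.

Lemma sle_mul2r s x y : sle x y -> sle (x * s) (y * s).
Proof.
move=> /sleP[->|[t ->]]; first exact: sle_refl.
by rewrite mulAC; apply: sle_mulr.
Qed.

Lemma sle_mul2l s x y : sle x y -> sle (s * x) (s * y).
Proof. by rewrite !(mulC s); apply: sle_mul2r. Qed.

Lemma sle_idemP e x : idem e -> (sle x e <-> e * x = x).
Proof.
move=> ee; split=> [/sleP[->//|[s ->]]|<-]; last exact: sle_mulr.
by rewrite mulgA ee.
Qed.

(** Divisibility is only a preorder on S, but on idempotents it is the
    semilattice order. *)
Lemma sle_idem_anti e f : idem e -> idem f -> sle e f -> sle f e -> e = f.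
Proof.
by move=> ee ff /(sle_idemP _ ff) ef /(sle_idemP _ ee) <-; rewrite -{1}ef mulC.
Qed.

Lemma idemM e f : idem e -> idem f -> idem (e * f).
Proof. by rewrite /idem mulACA => -> ->. Qed.

Definition up e : set S := [set x | sle e x].

Lemma prime_filter_up e : idem e -> prime_filter (up e).
Proof.
move=> ee x y; split=> [exy|[ex ey]].
  by split; apply: sle_trans exy _; [apply: sle_mulr|apply: sle_mull].
rewrite /up /= -ee; apply: sle_trans (sle_mul2r e ex) _.
exact: sle_mul2l.
Qed.

(* Unfolding [iterop] on an open exponent would hide the power. *)
Local Arguments spow : simpl never.

Lemma spowSS x n : spow x n.+2 = x * spow x n.+1. Proof. by []. Qed.

Lemma prime_filter_spow (P : set S) x n :
  prime_filter P -> P x -> P (spow x n.+1).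
Proof.
move=> PP Px; elim: n => // n IHn; rewrite spowSS; exact/PP.
Qed.

(** The idempotent found in the component of x lies between a power of x and
    x itself, because it equals all its powers. *)
Lemma complete_idem (completeS : complete_semigroup S) x :
  exists en : S * nat,
    [/\ idem en.1, sle en.1 x & sle (spow x en.2.+1) en.1].
Proof.
have [|e [[[|n] // _ xe] [[|m] // _ ex]] ee] :=
  completeS [set y | arch_equiv x y]; first by exists x.
exists (e, n); split=> //.
apply: sle_trans ex; rewrite (_ : spow e m.+1 = e); first exact: sle_refl.
by elim: m => // m IHm; rewrite spowSS IHm.
Qed.

(** * Moving along the elementary steps of a generated congruence *)

(** Mutual divisibility, Green's relation, of the images under p. *)
Definition green_rel (p : S -> S) : set (S * S) :=
  [set xy | sle (p xy.1) (p xy.2) /\ sle (p xy.2) (p xy.1)].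

(** The two instances of interest are the identity and multiplication by an
    idempotent f; the former plays the part of the latter when no f is
    available, which saves adjoining an identity to S. *)
Definition translation (p : S -> S) := forall x s, p (x * s) = p x * s.

Lemma translation_mul f : translation (mul f).
Proof. by move=> x s; rewrite mulgA. Qed.

(** This is a Rees congruence modulo Green's relation: the elements whose image
    is below some image of G form an ideal that is a union of Green classes,
    so that collapsing this ideal to one class keeps the relation
    transitive. *)
Lemma right_congruence_green_or_below (p : S -> S) (G : set S) :
  translation p ->
  right_congruence
    (green_rel p `|` [set xy | (exists2 x, G x & sle (p xy.1) (p x)) /\
                               (exists2 y, G y & sle (p xy.2) (p y))]).
Proof.
move=> pM; have below_le u v : sle (p u) (p v) ->
    (exists2 x, G x & sle (p v) (p x)) -> exists2 x, G x & sle (p u) (p x).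
  by move=> uv [x Gx vx]; exists x => //; apply: sle_trans vx.
have below_mul u s : (exists2 x, G x & sle (p u) (p x)) ->
    exists2 x, G x & sle (p (u * s)) (p x).
  by apply: below_le; rewrite pM; apply: sle_mulr.
split; first split.
- by move=> a; left; split; apply: sle_refl.
- by move=> a b [[ab ba]|[Ga Gb]]; [left|right].
- move=> a b c [[/= ab ba]|[/= Ga Gb]] [[/= bc cb]|[/= Gb' Gc]].
  + by left; split; [apply: sle_trans ab bc|apply: sle_trans cb ba].
  + by right; split=> //=; apply: below_le Gb'.
  + by right; split=> //=; apply: below_le Gb.
  + by right.
- move=> a b s [[/= ab ba]|[/= Ga Gb]].
    by left; split; rewrite /= !pM; apply: sle_mul2r.
  by right; split; apply: below_mul.
Qed.

(** In a chain of elementary steps from a to b, either every step stays within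
    the Green class of p a, or the first one that matters uses a generating
    pair (x, y) that p separates, and then p a is below p x. Instead of
    handling chains, collapse the ideal below all such x and apply minimality
    of rho. *)
Lemma fg_right_congruence_divisor (rho : set (S * S)) :
  fg_right_congruence rho ->
  exists2 F : set S, finite_set F &
    forall p a b, translation p -> rho (a, b) ->
      sle (p a) (p b) \/
      exists x y, [/\ F x, rho (x, y), ~ green_rel p (x, y)
                    & sle (p a) (p x)].
Proof.
move=> fg_rho.
have rho_sym a b : rho (a, b) -> rho (b, a).
  have [X _ ->] := fg_rho.
  by have [[_ + _] _] := right_congruence_gen_byP X; apply.
have [F finF Fsub] := fg_right_congruence_support fg_rho.
exists F => // p a b pM rho_ab.
pose G := [set x | F x /\ exists2 y, rho (x, y) & ~ green_rel p (x, y)].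
have := Fsub _ (right_congruence_green_or_below G pM) _ _ rho_ab.
case=> [x y Fx Fy rho_xy|[]|[[x [Fx [y rho_xy nxy]] ax] _]]; [|by left|].
  have [gxy|ngxy] := pselect (green_rel p (x, y)); first by left.
  right; split; [exists x|exists y]; try exact: sle_refl.
    by split=> //; exists y.
  by split=> //; exists x; [exact: rho_sym|move=> -[? ?]; apply: ngxy].
by right; exists x, y.
Qed.

(** * Idempotents *)

Hypothesis fnoethS : f_noetherian S.

(** Let P be the filter generated by B. The finitely many elements of F in P
    are all above a single z in B. Then the congruence given by [up z] agrees
    over F with the one given by P, hence contains it; as z and any e in B are
    on the same side of P, e lies in [up z]. *)
Lemma least_idem (B : set S) :
  B !=set0 -> B `<=` idem -> (forall x y, B x -> B y -> B (x * y)) ->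
  exists2 z, B z & forall e, B e -> sle z e.
Proof.
move=> [b0 Bb0] Bidem BM; pose P := [set x | exists2 e, B e & sle e x].
have PP : prime_filter P.
  move=> x y; split=> [[e Be exy]|[[e Be ex] [f Bf fy]]].
    by split; exists e => //; apply: sle_trans exy _;
      [apply: sle_mulr|apply: sle_mull].
  exists (e * f); first exact: BM.
  exact: sle_trans (sle_mul2r f ex) (sle_mul2l x fy).
have /fg_right_congruence_support[F finF Fsub] :
    fg_right_congruence (same_side [:: P]).
  by apply: fg_same_side => // Q; rewrite inE => /eqP ->.
have [z Bz zF] : exists2 z, B z & forall x, F x -> P x -> sle z x.
  have /finite_seqP[s ->] := finF; elim: s => [|x s [z Bz zs]].
    by exists b0.
  have [[e Be ex]|nPx] := pselect (P x); last first.
    by exists z => // y /=; rewrite inE => /predU1P[->//|]; apply: zs.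
  exists (z * e); first exact: BM.
  move=> y /=; rewrite inE => /predU1P[-> _|ys Py].
    exact: sle_trans (sle_mull _ _) ex.
  exact: sle_trans (sle_mulr _ _) (zs _ ys Py).
have PupP x : up z x -> P x by exists z.
have upz_cong : right_congruence (same_side [:: up z]).
  apply: right_congruence_same_side => Q; rewrite inE => /eqP ->.
  exact/prime_filter_up/Bidem.
exists z => // e Be.
have := Fsub _ upz_cong _ (z, e) _ (up z).
case=> [|||+ _]; last by apply; exact: sle_refl.
- move=> x y Fx Fy xy Q; rewrite inE => /eqP -> /=.
  have {}xy : P x <-> P y by apply: xy; rewrite inE.
  by split=> [/PupP/xy|/PupP/xy] ?; apply: zF.
- move=> Q; rewrite inE => /eqP -> /=.
  by split=> _; [exists e|exists z] => //; apply: sle_refl.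
- by rewrite inE.
Qed.

(** Well-founded induction on the order of idempotents: the terms of an infinite
    strictly decreasing sequence would form a multiplicatively closed set with
    no least element. *)
Lemma idem_ind (Q : S -> Prop) :
  (forall e, idem e ->
    (forall f, idem f -> sle f e -> f <> e -> Q f) -> Q e) ->
  forall e, idem e -> Q e.
Proof.
move=> Qind e0 e0e; apply: contrapT => nQ0.
have /choice[next nextP] : forall e, exists f, idem e /\ ~ Q e ->
    [/\ idem f /\ ~ Q f, sle f e & f <> e].
  move=> e; have [[ee nQe]|bad] := pselect (idem e /\ ~ Q e); last by exists e.
  apply: contrapT => none; apply: nQe; apply: Qind => // f ff fe fne.
  by apply: contrapT => nQf; apply: none; exists f.
pose u n := iter n next e0.
have uP n : idem (u n) /\ ~ Q (u n).
  by elim: n => // n IHn; have [] := nextP _ IHn.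
have uS n : sle (u n.+1) (u n) by have [] := nextP _ (uP n).
have u_decr m n : m <= n -> sle (u n) (u m).
  move=> /subnK <-; elim: (n - m)%N => [|k IHk]; first exact: sle_refl.
  exact: sle_trans (uS _) IHk.
have [|_ [n _ <-]|_ _ [m _ <-] [n _ <-]|_ [k _ <-] least] :=
    @least_idem (range u).
- by exists (u 0%N); exists 0%N.
- by have [] := uP n.
- have [/u_decr|/ltnW/u_decr] := leqP m n.
    by move/(sle_idemP _ (proj1 (uP m))) ->; exists n.
  by rewrite mulC; move/(sle_idemP _ (proj1 (uP n))) ->; exists m.
have [_ _] := nextP _ (uP k); apply.
apply: sle_idem_anti (uS k) _; [exact: (proj1 (uP k.+1))|exact: (proj1 (uP k))|].
by apply: least; exists k.+1.
Qed.

(** [idem_of x] is the idempotent of the archimedean component of x. *)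
Variables (idem_of : S -> S) (exp_of : S -> nat).
Hypothesis idem_ofP : forall x,
  [/\ idem (idem_of x), sle (idem_of x) x &
      sle (spow x (exp_of x).+1) (idem_of x)].

(** So an idempotent lies below x iff it lies below [idem_of x]: x and
    [idem_of x] are in the same prime filters [up e]. *)
Lemma sle_idem_of e x : idem e -> sle e x -> sle e (idem_of x).
Proof.
move=> ee ex; have [_ _] := idem_ofP x; apply: sle_trans.
exact: (prime_filter_spow _ (prime_filter_up ee)).
Qed.

(** Multiplication by f maps [up f] into the group of units of fS, all of whose
    elements divide one another. *)
Lemma green_rel_up f x y :
  idem f -> sle f x -> sle f y -> green_rel (mul f) (x, y).
Proof.
move=> ff fx fy; have f_le z w : sle f w -> sle (f * z) (f * w).
  move=> fw; apply: sle_trans (sle_mulr f z) _.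
  by rewrite -{1}ff; apply: sle_mul2l.
by split; apply: f_le.
Qed.

(** Fix an idempotent b strictly below e. Any other g strictly below e is on the
    same side of [up e] as b, so either g <= b, or g <= x for some x in F.
    By [green_rel_up] this x is outside [up e]; then the idempotent
    e * idem_of x is strictly below e, and it is above g. *)
Lemma finite_idem_below e : idem e -> finite_set [set g | idem g /\ sle g e].
Proof.
move: e; apply: idem_ind => e ee IHe.
have [[b [bb be bne]]|none] :=
    pselect (exists b, [/\ idem b, sle b e & b <> e]); last first.
  apply: (@sub_finite_set _ _ [set e]) (finite_set1 e) => g [gg ge] /=.
  by apply: contrapT => gne; apply: none; exists g.
have PP P : P \in [:: up e] -> prime_filter P.
  by rewrite inE => /eqP ->; apply: prime_filter_up.
have [F finF Fdiv] :=
  fg_right_congruence_divisor (fg_same_side fnoethS PP).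
pose C := b |` ((fun x => e * idem_of x) @` (F `\` up e)).
have finC : finite_set C.
  by rewrite finite_setU; split => //; exact/finite_image/finite_setD.
apply: (@sub_finite_set _ _
  (e |` \bigcup_(c in C) [set g | idem g /\ sle g c])); last first.
  rewrite finite_setU; split=> //; apply: bigcup_finite => // c [->|].
    exact: IHe.
  move=> [x [Fx nex] <-]; have [xx le_x _] := idem_ofP x.
  apply: IHe; [exact: idemM|exact: sle_mulr|move=> ex; apply: nex].
  by rewrite /up /= -ex; apply: sle_trans (sle_mull _ _) le_x.
move=> g [gg ge]; have [->|gne] := pselect (g = e); first by left.
right; have not_up c : idem c -> sle c e -> c <> e -> ~ up e c.
  by move=> cc ce cne ec; apply: cne; apply: sle_idem_anti.
have [|gb|[x [y [Fx xy nxy gx]]]] :=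
    Fdiv (mul e) g b (@translation_mul e).
- move=> P; rewrite inE => /eqP -> /=.
  by split=> [/not_up|/not_up]; case.
- exists b; first by left.
  split=> //; move: gb; rewrite (proj1 (sle_idemP _ ee) ge).
  by rewrite (proj1 (sle_idemP _ ee) be).
- have nex : ~ up e x.
    move=> ex; apply: nxy; apply: green_rel_up => //.
    by apply/(xy (up e)) => //; rewrite inE.
  exists (e * idem_of x); first by right; exists x.
  split=> //; apply/(prime_filter_up gg); split=> //; apply: sle_idem_of => //.
  move: gx; rewrite (proj1 (sle_idemP _ ee) ge) => gx.
  exact: sle_trans gx (sle_mull _ _).
Qed.

(** Same argument for the universal congruence, given by the empty list of
    filters: it is as if an identity e were adjoined above all idempotents. *)
Lemma finite_idem : finite_set idem.
Proof.
have PP (P : set S) : P \in [::] -> prime_filter P by [].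
have [F finF Fdiv] := fg_right_congruence_divisor (fg_same_side fnoethS PP).
have [b0|none] := pselect (exists b, idem b); last first.
  by apply: (@sub_finite_set _ _ set0) => // g gg; apply: none; exists g.
have [b bb] := b0.
apply: (@sub_finite_set _ _
  (\bigcup_(c in b |` (idem_of @` F)) [set g | idem g /\ sle g c])).
  move=> g gg.
  have [//|//|gb|[x [y [Fx _ _ gx]]]] := Fdiv id g b.
    by exists b => //; left.
  exists (idem_of x); first by right; exists x.
  by split=> //; apply: sle_idem_of.
apply: bigcup_finite.
  by rewrite finite_setU; split=> //; apply: finite_image.
move=> c [->|[x _ <-]]; first exact: finite_idem_below.
by apply: finite_idem_below; have [] := idem_ofP x.
Qed.

(** * The maximal subgroups *)

Definition unit_group e : set S := [set u | e * u = u /\ sle e u].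

(** Inverses in the group of units of eS; x need not lie in eS, in which case
    t is the inverse of e * x. *)
Lemma unit_group_inverse e x : idem e -> sle e x ->
  exists t, [/\ sle e t, e * t = t & x * t = e].
Proof.
move=> ee /sleP[<-|[t et]].
  by exists e; split=> //; apply: sle_refl.
exists (e * t); split.
- rewrite -{1}ee; apply: sle_mul2l; rewrite {1}et; exact: sle_mull.
- by rewrite mulgA ee.
- by rewrite mulgA mulAC -et.
Qed.

(** H is generated by e, the images e * x of the elements x of F above e, and
    their inverses, so H is a subgroup. On [up e], theta relates u and v when
    e * u and e * v are in the same coset of H; it contains the congruence
    given by [up e], and so every u in the group is in the coset of e. *)
Lemma fg_unit_group e : idem e ->
  exists2 Z : set S, finite_set Z & unit_group e `<=` smallest (@subsemigroup S) Z.
Proof.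
move=> ee; have upP := prime_filter_up ee.
have PP P : P \in [:: up e] -> prime_filter P by rewrite inE => /eqP ->.
have [F finF Fsub] := fg_right_congruence_support (fg_same_side fnoethS PP).
have /choice[inv invP] : forall x, exists t, sle e x ->
    [/\ sle e t, e * t = t & x * t = e].
  move=> x; have [/(unit_group_inverse ee)[t ?]|nex] := pselect (sle e x).
    by exists t.
  by exists x.
pose Z := e |` (mul e @` (F `&` up e) `|` inv @` (F `&` up e)).
pose H := smallest (@subsemigroup S) Z.
have HM : subsemigroup H by apply: subsemigroup_smallest.
have ZH : Z `<=` H by apply: sub_gen_smallest.
have He : H e by apply: ZH; left.
have Hfix : H `<=` [set h | e * h = h].
  apply: smallest_sub.
    by move=> a b /= ea eb; rewrite mulgA ea.
  move=> h [->//|[[x _ <-]|[x [_ ex] <-]]]; first by rewrite /= mulgA ee.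
  by have [] := invP x ex.
have Hinv : H `<=` [set h | exists2 k, H k & k * h = e].
  apply: smallest_sub.
    move=> a b /= [k Hk ka] [l Hl lb]; exists (k * l); first exact: HM.
    by rewrite mulACA ka lb.
  move=> h [->|[[x [Fx ex] <-]|[x [Fx ex] <-]]] /=; first by exists e.
    exists (inv x); first by apply: ZH; right; right; exists x.
    by have [_ ei xi] := invP x ex; rewrite mulgA (mulC _ e) ei mulC.
  exists (e * x); first by apply: ZH; right; left; exists x.
  by have [_ ei xi] := invP x ex; rewrite -mulgA xi.
(* H u and H v meet: in this form symmetry and transitivity need no inverses. *)
pose theta : set (S * S) := [set uv | (up e uv.1 <-> up e uv.2) /\
  (up e uv.1 -> exists h k, [/\ H h, H k & h * uv.1 = k * uv.2])].
have thetaP : right_congruence theta.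
  split; first split.
  - by move=> a; split=> // _; exists e, e; split.
  - move=> a b [/= ab abH]; split=> /=; first exact: iff_sym.
    by move=> /ab/abH[h [k [Hh Hk hk]]]; exists k, h.
  - move=> a b c [/= ab abH] [/= bc bcH]; split=> /=; first exact: iff_trans bc.
    move=> ea; have [h [k [Hh Hk hk]]] := abH ea.
    have [h' [k' [Hh' Hk' hk']]] := bcH (proj1 ab ea).
    exists (h' * h), (k * k'); split; [exact: HM|exact: HM|].
    by rewrite -!mulgA hk -hk' !mulgA (mulC h').
  - move=> a b s [/= ab abH]; split=> /=.
      by split=> /upP[? ?]; apply/upP; split=> //; apply/ab.
    move=> /upP[/abH[h [k [Hh Hk hk]]] _]; exists h, k; split=> //.
    by rewrite !mulgA hk.
exists Z => // [|u [eu ue]].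
  rewrite !finite_setU; split=> //.
  by split; apply: finite_image; apply: finite_setIl.
have : theta (u, e).
  apply: Fsub thetaP _ (u, e) _ => [x y Fx Fy xy|P].
    (* (e y) x = (e x) y, with both coefficients among the generators of H. *)
    have {}xy : up e x <-> up e y by apply: xy; rewrite inE.
    split=> //= ex; have ey := proj1 xy ex; exists (e * y), (e * x); split.
    - by apply: ZH; right; left; exists y.
    - by apply: ZH; right; left; exists x.
    - by rewrite mulAC.
  rewrite inE => /eqP -> /=; split=> _; [exact: sle_refl|exact: ue].
case=> /= _ /(_ ue)[h [k [Hh Hk hk]]].
have [h' Hh' h'h] := Hinv h Hh.
by rewrite -eu -h'h -mulgA hk; exact: HM Hh' (HM _ _ Hk He).
Qed.

(** * Factoring out generators *)

(** Let f be the least idempotent fixing a, if any. Divide a, compared through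
    multiplication by f (or the identity), with the idempotent of its
    component: the alternative a <= idem_of a being excluded, a <= f x with x
    and some y in the same component but separated by f. If [idem_of x] fixed
    a, it would be above f, so x and y would both be in [up f], which
    [green_rel_up] forbids. *)
Lemma divide_step : exists2 F : set S, finite_set F &
  forall a, idem_of a * a <> a ->
    exists x, [/\ F x, idem_of x * a <> a & a = x \/ exists s, a = x * s].
Proof.
have [E idemE] := (proj1 (finite_seqP _)) finite_idem.
have EP e : (e \in E) = idem e :> Prop by rewrite idemE.
have PP P : P \in map up E -> prime_filter P.
  by move=> /mapP[e eE ->]; apply: prime_filter_up; rewrite -EP.
have [F finF Fdiv] := fg_right_congruence_divisor (fg_same_side fnoethS PP).
exists F => // a na; have [ea le_a _] := idem_ofP a.
have a_eq : same_side (map up E) (a, idem_of a).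
  move=> _ /mapP[e eE ->]; rewrite EP in eE; split=> /= [|eia].
    exact: sle_idem_of.
  exact: sle_trans eia le_a.
have [[f0 f0B]|none] := pselect (exists f, idem f /\ f * a = a); last first.
  have [//|//|/(sle_idemP _ ea)//|[x [y [Fx _ _ /sleP ax]]]] :=
    Fdiv id a (idem_of a).
  exists x; split=> // xa; apply: none; exists (idem_of x); split=> //.
  by have [] := idem_ofP x.
have [||e f [ee ea'] [ff fa]|f [ff fa] f_least] :=
    @least_idem [set f | idem f /\ f * a = a].
- by exists f0.
- by move=> f [].
- by split; [exact: idemM|rewrite -mulgA fa].
have [//|afa|[x [y [Fx xy nxy ax]]]] :=
    Fdiv (mul f) a (idem_of a) (@translation_mul f).
  case: na; apply/(sle_idemP _ ea).
  by rewrite -{1}fa; apply: sle_trans afa (sle_mull _ _).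
exists x; split=> //; last first.
  by apply/sleP; rewrite -{1}fa; apply: sle_trans ax (sle_mull _ _).
move=> xa; have [ex le_x _] := idem_ofP x; apply: nxy.
have fx : sle f x by apply: sle_trans le_x; apply: f_least.
apply: green_rel_up => //; apply/(xy (up f)) => //.
by apply: map_f; rewrite EP.
Qed.

(** Otherwise divisibility of a by a power of x would pass to s, and from s to
    a with one more factor x, up to the power of x that lies below [idem_of x];
    then [idem_of x] would fix a. *)
Lemma divide_fresh_power a x s : idem_of x * a <> a -> a = x * s ->
  exists2 k, k < (exp_of x).+1 &
    sle a (spow x k.+1) /\ ~ sle s (spow x k.+1).
Proof.
move=> na axs; apply: contrapT => none; apply: na.
have [ex _ xn_le] := idem_ofP x; apply/(sle_idemP _ ex).
apply: sle_trans xn_le.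
have a_le k : k < (exp_of x).+1 -> sle a (spow x k.+1).
  elim: k => [_|k IHk lt_k]; first by rewrite axs; apply: sle_mulr.
  rewrite spowSS {1}axs; apply: sle_mul2l; apply: contrapT => nsk.
  apply: none; exists k; first exact: ltnW.
  by split=> //; apply: IHk; apply: ltnW.
exact: a_le.
Qed.

Definition power_divisors (F : seq S) a :=
  (\sum_(x <- F) \sum_(k < (exp_of x).+1) `[< sle a (spow x k.+1) >])%N.

Lemma power_divisors_lt (F : seq S) a x s :
  x \in F -> idem_of x * a <> a -> a = x * s ->
  (power_divisors F s < power_divisors F a)%N.
Proof.
move=> xF na axs; have [k lt_k [ak nsk]] := divide_fresh_power na axs.
have le_term y j : (`[< sle s (spow y j) >] <= `[< sle a (spow y j) >])%N.
  case: asboolP => // sj; case: asboolP => //; case.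
  by apply: sle_trans sj; rewrite axs; apply: sle_mull.
rewrite /power_divisors !(big_rem x xF) /=.
rewrite -addSn; apply: leq_add; last first.
  by apply: leq_sum => y _; apply: leq_sum => j _; apply: le_term.
rewrite (bigD1 (Ordinal lt_k)) //= [leqRHS](bigD1 (Ordinal lt_k)) //= -addSn.
apply: leq_add; last first.
  by apply: leq_sum => j _; apply: le_term.
by rewrite (asboolF nsk) (asboolT ak).
Qed.

(** Induction on the number of [power_divisors]. *)
Lemma finitely_generated_of_idem_of : finitely_generated S.
Proof.
have [F finF Fdiv] := divide_step.
have /choice[Z ZP] : forall e, exists Z : set S, idem e ->
    finite_set Z /\ unit_group e `<=` smallest (@subsemigroup S) Z.
  move=> e; have [/fg_unit_group[Z finZ eZ]|ne] := pselect (idem e).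
    by exists Z.
  by exists set0.
pose X := F `|` \bigcup_(e in idem) Z e.
exists X.
  rewrite finite_setU; split=> //; apply: bigcup_finite finite_idem _ => e ee.
  by have [] := ZP e ee.
apply/seteqP; split=> // a _.
have XM := @subsemigroup_smallest _ X.
have sub_X := @sub_gen_smallest _ (@subsemigroup S) X.
(* [power_divisors] counts along a list r enumerating F. *)
have [r Fr] := (proj1 (finite_seqP _)) finF.
have [n] := ubnP (power_divisors r a); elim: n a => // n IHn a lt_a.
have [ea le_a _] := idem_ofP a.
have [eaa|na] := pselect (idem_of a * a = a).
  have [_ Zea] := ZP _ ea.
  apply: (sub_smallest2r XM) (Zea a (conj eaa le_a)) => z Zz.
  by right; exists (idem_of a).
have [x [Fx nx [->|[s axs]]]] := Fdiv a na; first by apply: sub_X; left.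
rewrite axs; apply: XM; first by apply: sub_X; left.
have xr : x \in r by rewrite Fr in Fx.
apply: IHn; rewrite -ltnS; apply: leq_trans lt_a.
exact: power_divisors_lt xr nx axs.
Qed.

End Commutative.

Theorem proposition6p8 (S : semigroupType)
    (commS : forall x y : S, commute x y)
    (completeS : complete_semigroup S)
    (fnoethS : f_noetherian S) :
  finitely_generated S.
Proof.
have /choice[en enP] := complete_idem completeS.
exact: (@finitely_generated_of_idem_of _ commS fnoethS
          (fun x => (en x).1) (fun x => (en x).2) enP).
Qed.
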